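(* Let $d, N\in \mathbb{N}$ and $\rho \in [0,\infty)$. Let $X= (X_n)_{n\in[N]}$ be a set of $\mathcal{D}^d_0$-$e^{\rho d}$-negatively dependent random points in $[0,1)^d$ such that each $X_n$ is uniformly distributed in $[0,1)^d$. Then for every $c>0$ $$D^*_N(X) \leq c\sqrt{\frac{d}{N}}$$ holds with probability at least $1-e^{-(1.6741\cdot c^2 -10.7042- \rho)\cdot d}$, implying that for every $q\in (0,1)$ $$D^*_N(X) \leq 0.7729 \sqrt{ 10.7042 + \rho + \frac{\ln \big( (1-q)^{-1} \big) }{d}}\; \sqrt{\frac{d}{N}}$$ holds with probability at least $q$.
   Context: Notation: $[N]=\{1,\dots,N\}$; $\lambda^d$ is Lebesgue measure on $\mathbb{R}^d$; for $x,y\in\mathbb{R}^d$, $[x,y):=\prod_{j=1}^d[x_j,y_j)$; $\mathbf{1}_S$ is the indicator function of $S$. All random variables live on a common probability space $(\Omega,\Sigma,\mathbb{P})$. Star discrepancy: for an $N$-point multiset $P=\{p_1,\dots,p_N\}\subset[0,1)^d$ (points counted with multiplicity) and measurable $T\subseteq[0,1)^d$ put $D_N(P,T):=\big|\frac1N|P\cap T|-\lambda^d(T)\big|$, and $D_N^*(P):=\sup_{y\in[0,1]^d}D_N(P,[0,y))$. $\gamma$-negative dependence: let $\gamma\ge1$. Random variables $T_1,\dots,T_N$ with values in $\{0,1\}$ are called $\gamma$-negatively dependent if for all $u\subseteq[N]$ both $\mathbb{P}\big(\bigwedge_{j\in u}T_j=1\big)\le\gamma\prod_{j\in u}\mathbb{P}(T_j=1)$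 and $\mathbb{P}\big(\bigwedge_{j\in u}T_j=0\big)\le\gamma\prod_{j\in u}\mathbb{P}(T_j=0)$. Let $\mathcal{C}^d_0:=\{[0,a)\mid a\in[0,1]^d\}$ and $\mathcal{D}^d_0:=\{B\setminus A\mid A,B\in\mathcal{C}^d_0\}$. Random points $X_1,\dots,X_N$ in $[0,1)^d$ are called $\mathcal{D}^d_0$-$\gamma$-negatively dependent if for every $S\in\mathcal{D}^d_0$ the random variables $\mathbf{1}_S(X_1),\dots,\mathbf{1}_S(X_N)$ are $\gamma$-negatively dependent. *)

(* Defs.v *)
From HB Require Import structures.
From mathcomp Require Import all_boot all_order all_algebra.
From mathcomp Require Import all_classical all_reals all_analysis.

Set Implicit Arguments.
Unset Strict Implicit.
Unset Printing Implicit Defensive.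

Import Order.TTheory GRing.Theory Num.Theory.
Import numFieldNormedType.Exports.

Local Open Scope classical_set_scope.
Local Open Scope ring_scope.

(* Points of R^d are d-tuples: the library equips d.-tuple R with the
   sigma-algebra generated by the coordinate maps, i.e. the Borel sets of R^d. *)

Section lebesgue_measure_tuple.
Context {R : realType}.

Definition tuple_cons n (z : measurableTypeR R * n.-tuple R) : n.+1.-tuple R :=
  [tuple of z.1 :: z.2].

Definition tuple_uncons n (t : n.+1.-tuple R) :
    measurableTypeR R * n.-tuple R :=
  (thead t, [tuple of behead t]).

Lemma tuple_consK n : cancel (@tuple_cons n) (@tuple_uncons n).
Proof. by move=> [x t]; congr pair; apply/val_inj. Qed.

Lemma measurable_tuple_cons n : measurable_fun [set: _] (@tuple_cons n).
Proof.
apply: (measurable_cons (f := fst) (g := snd)); last exact: measurable_snd.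
exact: (@measurable_fst _ _ (measurableTypeR R)).
Qed.

Lemma measurable_tuple_uncons n : measurable_fun [set: _] (@tuple_uncons n).
Proof.
apply: measurable_fun_pair; last exact: measurable_behead.
exact: (measurable_tnth ord0).
Qed.

HB.instance Definition _ n :=
  isMeasurableFun.Build _ _ _ _ (@tuple_cons n) (@measurable_tuple_cons n).

Section cons_measure.
Variables (n : nat) (mu : {sigma_finite_measure set (n.-tuple R) -> \bar R}).

Definition cons_measure :=
  pushforward (@lebesgue_measure R \x mu)%E (@tuple_cons n).

Let cons_measure0 : cons_measure set0 = 0%E.
Proof. exact: measure0. Qed.

Let cons_measure_ge0 A : (0 <= cons_measure A)%E.
Proof. exact: measure_ge0. Qed.

Let cons_measure_sigma_additive : semi_sigma_additive cons_measure.
Proof. exact: measure_semi_sigma_additive. Qed.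

HB.instance Definition _ := isMeasure.Build _ _ _ cons_measure
  cons_measure0 cons_measure_ge0 cons_measure_sigma_additive.

Let cons_measure_sigma_finite : sigma_finite setT cons_measure.
Proof.
have /sigma_finiteP[F [TF ndF Foo]] := sigma_finiteT (@lebesgue_measure R).
have /sigma_finiteP[G [TG ndG Goo]] := sigma_finiteT mu.
exists (fun k => @tuple_uncons n @^-1` (F k `*` G k)).
  apply/esym; rewrite -subTset => t _.
  have [i _ Fi] : (\bigcup_i F i) (thead t) by rewrite -TF.
  have [j _ Gj] : (\bigcup_i G i) [tuple of behead t] by rewrite -TG.
  exists (maxn i j) => //; split => /=.
  - by move: Fi; apply/subsetPset/ndF/leq_maxl.
  - by move: Gj; apply/subsetPset/ndG/leq_maxr.
move=> k; have [mF Fk] := Foo k; have [mG Gk] := Goo k; split.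
  rewrite -[X in measurable X]setTI; apply: measurable_tuple_uncons => //.
  exact: measurableX.
rewrite /cons_measure /pushforward -comp_preimage (_ : _ \o _ = id).
  by rewrite preimage_id product_measure1E// lte_mul_pinfty// ge0_fin_numE.
by apply/funext => z /=; rewrite tuple_consK.
Qed.

HB.instance Definition _ := Measure_isSigmaFinite.Build _ _ _ cons_measure
  cons_measure_sigma_finite.

End cons_measure.

(* Lebesgue measure on R^n as the n-fold product of lebesgue_measure, the
   product on R * n.-tuple R being transported to n.+1.-tuple R. *)
Fixpoint lebesgue_measure_tuple n :
    {sigma_finite_measure set (n.-tuple R) -> \bar R} :=
  if n is m.+1 then cons_measure (lebesgue_measure_tuple m)
  else \d_([tuple] : 0.-tuple R).

End lebesgue_measure_tuple.

Section star_discrepancy.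
Context {R : realType} {d : nat}.

Definition box (x y : d.-tuple R) : set (d.-tuple R) :=
  [set z | forall j, tnth x j <= tnth z j < tnth y j].

Lemma measurable_box x y : measurable (box x y).
Proof.
rewrite (_ : box x y = \bigcap_(j in [set: 'I_d])
    ((fun z => tnth z j) @^-1` `[tnth x j, tnth y j[%classic)).
  apply: fin_bigcap_measurable => [|j _]; first exact: finite_finset.
  rewrite -[X in measurable X]setTI; exact: measurable_tnth.
apply/seteqP; split=> z /=.
  by move=> xzy j _ /=; rewrite in_itv/=.
by move=> xzy j; have := xzy j I; rewrite /= in_itv.
Qed.

Definition tuple0 : d.-tuple R := [tuple 0 | _ < d].

Definition half_open_cube : set (d.-tuple R) :=
  [set z | forall j, 0 <= tnth z j < 1].

Definition closed_cube : set (d.-tuple R) :=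
  [set z | forall j, 0 <= tnth z j <= 1].

(* An N-point multiset is a family p : 'I_N -> R^d, so that multiplicities are
   accounted for by counting indices. *)
Definition discrepancy N (p : 'I_N -> d.-tuple R) (T : set (d.-tuple R)) : R :=
  `|#|[pred i | p i \in T]|%:R / N%:R - fine (lebesgue_measure_tuple d T)|.

Definition star_discrepancy N (p : 'I_N -> d.-tuple R) : R :=
  sup [set discrepancy p (box tuple0 y) | y in closed_cube].

Definition anchored_boxes : set (set (d.-tuple R)) :=
  [set box tuple0 a | a in closed_cube].

Definition anchored_box_differences : set (set (d.-tuple R)) :=
  [set B `\` A | A in anchored_boxes & B in anchored_boxes].

End star_discrepancy.

Lemma lebesgue_measure_tuple_box (R : realType) d (x y : d.-tuple R) :
  (forall j, tnth x j <= tnth y j) ->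
  lebesgue_measure_tuple d (box x y) = (\prod_j (tnth y j - tnth x j))%:E.
Proof.
elim: d x y => [|d IH] x y xy.
  by rewrite big_ord0 /= diracE mem_set// => -[].
case/tupleP: x xy => x0 x; case/tupleP: y => y0 y xy.
have xy0 : x0 <= y0 := xy ord0.
have xyS j : tnth x j <= tnth y j by have := xy (lift ord0 j); rewrite !tnthS.
rewrite /= /cons_measure /pushforward.
rewrite (_ : _ @^-1` _ = `[x0, y0[%classic `*` box x y).
  rewrite product_measure1E; [|exact: (measurable_itv `[x0, y0[)|exact: measurable_box].
  rewrite IH// [X in (X * _)%E](lebesgue_measure_itv `[x0, y0[)/= lte_fin big_ord_recl.
  under [in RHS]eq_bigr do rewrite !tnthS.
  have [xy0'|yx0] := ltP x0 y0; first by rewrite EFinN -EFinB EFinM.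
  by rewrite (@le_anti _ _ x0 y0) ?xy0//= subrr mul0r mul0e.
apply/seteqP; split=> -[z0 z] /=.
  move=> xzy; split; first by have := xzy ord0; rewrite in_itv.
  by move=> j; have := xzy (lift ord0 j); rewrite !tnthS.
move=> [z0P zP] j; case: (unliftP ord0 j) => [i|] ->; last first.
  by move: z0P; rewrite in_itv.
by rewrite !tnthS; exact: zP.
Qed.

Section negative_dependence.
Context {R : realType} {dO : measure_display} {Omega : measurableType dO}.
Variable P : probability Omega R.

(* {0,1}-valued random variables are given as bool-valued maps. *)
Definition negatively_dependent (gamma : R) N (T : 'I_N -> Omega -> bool) :=
  forall u : {set 'I_N},
    (P [set w | forall j, j \in u -> T j w = true]
       <= gamma%:E * \prod_(j in u) P [set w | T j w = true])%E /\
    (P [set w | forall j, j \in u -> T j w = false]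
       <= gamma%:E * \prod_(j in u) P [set w | T j w = false])%E.

Definition class_negatively_dependent d (S : set (set (d.-tuple R)))
    (gamma : R) N (X : 'I_N -> Omega -> d.-tuple R) :=
  forall A, S A -> negatively_dependent gamma (fun n w => X n w \in A).

Definition uniform_on_half_open_cube d (X : {RV P >-> d.-tuple R}) :=
  forall A : set (d.-tuple R), measurable A ->
    distribution P X A = lebesgue_measure_tuple d (A `&` half_open_cube).

(* The value of P is only constrained on measurable sets, hence the first
   conjunct. *)
Definition holds_with_probability_at_least (E : set Omega) (p : R) :=
  measurable E /\ (p%:E <= P E)%E.

End negative_dependence.

(* Main.v *)
Require Import Defs.
From mathcomp Require Import all_boot all_order all_algebra.
From mathcomp Require Import all_classical all_reals all_analysis.
From mathcomp Require Import ring lra zify.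

Set Implicit Arguments.
Unset Strict Implicit.
Unset Printing Implicit Defensive.

Import Order.TTheory GRing.Theory Num.Theory.
Import numFieldNormedType.Exports.

Local Open Scope classical_set_scope.
Local Open Scope ring_scope.

(** The proof is a chaining argument over bracketing covers of the anchored boxes.

    A finite set of corners such that every box [0, y) lies between two boxes
    whose volumes differ by at most h reduces the discrepancy of all boxes to
    that of the corners, at the price h.  One cover does not suffice: with h of
    order c sqrt(d/N) its logarithmic size grows with ln N.  Hence covers of
    mesh 1/2000, 1/(2000 100), 1/(2000 100^2) and so on are used together.  A
    corner x of level k+1 has a lower bracket v at level k, and its local
    discrepancy is that of v plus that of the difference [0, x) minus [0, v),
    a set of measure at most the mesh of level k ([chaining]).  All the sets that
    occur are differences of anchored boxes, for which negative dependence is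
    assumed.

    For such a set the number of points in it is a sum of gamma-negatively
    dependent indicators.  Expanding the moment generating function over the
    subsets of indices ([chernoff_hits]) gives the same tails as independence,
    up to the factor gamma: Hoeffding's bound at level 0, and a Bernstein bound
    exp(-N t^2 / (4 delta)) for a set of measure at most delta, which is much
    smaller at the finer levels.

    The covers ([bracketing_cover]) are made of points with coordinates
    exp(-(h/d) i), i a natural number.  Such a box has volume exp(-(h/d) I) with
    I the sum of the exponents, so only I up to about d ln(1/h)/h matters, and
    there are at most e^(-1) (e (ln(1/h)/h + 2))^d points of this kind.  At mesh
    1/2000 the base of this power is below exp(10.7042).

    With T = c sqrt(d/N) the allowed deviation is 0.915 T at level 0 and
    0.074 8^(-k) T at level k+1; together these stay below T.  As
    2 * 0.915^2 > 1.6741, level 0 fails with probability at most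
    (2/e) gamma exp(-(1.6741 c^2 - 10.7042) d), and level k with at most 4^(-k)
    times that ([level_bound]), unless c is so small that the claim is void.  The sum over k is covered by (2/e)(4/3) < 1.
    The chain stops at the first mesh below the next allowed deviation, so that
    the remaining bracketing error is paid for by one more term of the sum.

    The second claim is the first one with c chosen so that the failure
    probability is 1 - q, because 1.6741 * 0.7729^2 > 1. *)

(** * Exponential inequalities *)

(** From 1 - a/n <= exp(-a/n) one gets exp a <= (1 - a/n)^(-n).  For negative x
    the case n = 1 is enough; for positive x it is too weak by a factor 2 in the
    quadratic term, and n = 3 is the first case that suffices up to 1/2. *)
Lemma expR_quadratic (R : realType) (x : R) :
  `|x| <= 1 / 2 -> expR x <= 1 + x + x ^+ 2.
Proof.
rewrite ler_norml => /andP[xl xr].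
have sub a n : (0 < n)%N -> 0 < 1 - a / n%:R :> R -> expR a * (1 - a / n%:R) ^+ n <= 1.
  move=> n0 an0; rewrite -ler_pdivlMr ?exprn_gt0// mul1r -[leLHS]invrK -expRN.
  rewrite lef_pV2 ?posrE ?exprn_gt0 ?expR_gt0//.
  have -> : - a = n%:R * (- (a / n%:R)).
    by rewrite mulrN mulrC divfK// pnatr_eq0 -lt0n.
  rewrite expRM_natl lerXn2r ?nnegrE ?expR_ge0 ?(ltW an0)//.
  exact: expR_ge1Dx.
have [x0|x0] := leP x 0.
  have := @sub x 1%N isT; rewrite divr1 expr1 => /(_ ltac:(lra)).
  have := expR_gt0 x; set E := expR x => E0 H.
  have : 0 <= (1 - E * (1 - x)) * (1 + x + x ^+ 2) + E * (- x ^+ 3).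
    apply: addr_ge0; apply: mulr_ge0; [lra|nra|lra|].
    by rewrite exprS -mulNr mulr_ge0 ?sqr_ge0// oppr_ge0.
  by move=> K; lra.
have := @sub x 3 isT => /(_ ltac:(lra)).
have := expR_gt0 x; set E := expR x => E0 H.
have Q : 1 <= (1 - x / 3) ^+ 3 * (1 + x + x ^+ 2).
  have : 0 <= x ^+ 2 * (9 - 19 * x + 8 * x ^+ 2 - x ^+ 3).
    by rewrite mulr_ge0 ?sqr_ge0//; nra.
  by lra.
have : E <= E * ((1 - x / 3) ^+ 3 * (1 + x + x ^+ 2)) by rewrite ler_peMr// ltW.
move=> /le_trans; apply; rewrite mulrA -[leRHS]mul1r ler_wpM2r//; nra.
Qed.

Lemma is_derive_nondecr (R : realType) (f g : R -> R) :
  (forall x : R, is_derive x 1 f (g x)) -> (forall x, 0 <= x -> 0 <= g x) ->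
  forall x, 0 <= x -> f 0 <= f x.
Proof.
move=> df g0 x x0.
have [->//|xn0] := eqVneq x 0.
have xp : 0 < x by rewrite lt0r xn0.
apply: (@ger0_derive1_ndecr R f 0 x) => //.
- move=> y; rewrite in_itv/= => /andP[y0 _].
  by have [_ dfy] := df y; rewrite derive1E dfy g0// ltW.
- apply: derivable_within_continuous => y _.
  by have [] := df y.
Qed.

(** Hoeffding's lemma for a Bernoulli variable.  In logarithmic form the
    difference F of the two sides vanishes to first order at 0, and F'' is
    1/4 - q (1 - q) = (1/2 - q)^2, with q the success probability of the
    exponentially tilted variable. *)
Lemma hoeffding_bernoulli (R : realType) (p l : R) : 0 <= p <= 1 -> 0 <= l ->
  1 + p * (expR l - 1) <= expR (p * l + l ^+ 2 / 8).
Proof.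
move=> /andP[p0 p1] l0.
have D0 x : 0 < 1 + p * (expR x - 1).
  have := expR_gt0 x; set E := expR x => E0.
  have [->|pn0] := eqVneq p 0; first lra.
  have : 0 < p * E by rewrite mulr_gt0// lt0r pn0.
  nra.
pose D x := 1 + p * (expR x - 1).
pose q x := p * expR x * (D x)^-1.
have dD (x : R) : is_derive x 1 D (p * expR x).
  rewrite /D; apply: is_derive_eq.
  by rewrite subr0 add0r mul1r.
have dlnD (x : R) : is_derive x 1 (fun y => ln (D y)) (q x).
  have dln := is_derive1_ln (D0 x).
  have := @is_derive1_comp R (@ln R) D x _ _ dln (dD x).
  by rewrite /q mulrC.
have dq (x : R) : is_derive x 1 q (q x * (1 - q x)).
  have Dn0 : D x != 0 by rewrite gt_eqF// D0.
  have dV := is_deriveV Dn0 (dD x).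
  rewrite /q; apply: is_derive_eq.
  rewrite /GRing.scale /=; field.
  exact: Dn0.
pose F x := p * x + x ^+ 2 / 8 - ln (D x).
have dF (x : R) : is_derive x 1 F (p + x / 4 - q x).
  rewrite /F; apply: is_derive_eq.
  rewrite /GRing.scale /=; lra.
have dF' (x : R) : is_derive x 1 (fun x => p + x / 4 - q x) ((1 / 2 - q x) ^+ 2).
  apply: is_derive_eq.
  rewrite /GRing.scale /=; lra.
have F'0 x : 0 <= x -> 0 <= p + x / 4 - q x.
  move=> x0; have := @is_derive_nondecr R _ _ dF' (fun y _ => sqr_ge0 _) x x0.
  by rewrite /q /D expR0 subrr mulr0 addr0 invr1 mulr1 mul0r addr0 mulr1 subrr.
have := @is_derive_nondecr R _ _ dF F'0 l l0.
rewrite /F [X in ln X](_ : D 0 = 1); last by rewrite /D expR0 subrr mulr0 addr0.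
rewrite ln1 expr0n mul0r mulr0 addr0 subrr subr_ge0 => h.
by rewrite -/(D l) -[leLHS](@lnK R) ?posrE ?D0// ler_expR.
Qed.

(** The weak form n! >= e (n/e)^n of Stirling's formula; its factor e absorbs
    the factor 2 of the two-sided tails in the final union bound. *)
Lemma ler1_fact (R : realType) (n : nat) : (0 < n)%N ->
  n%:R ^+ n <= expR (n%:R - 1) * n`!%:R :> R.
Proof.
case: n => // n _; elim: n => [|n IH].
  by rewrite subrr expR0 mulr1.
rewrite factS natrM exprS mulrCA ler_wpM2l//.
have -> : n.+2%:R = n.+1%:R * (1 + n.+1%:R^-1) :> R.
  by rewrite mulrDr mulr1 divff ?pnatr_eq0// natr1.
rewrite exprMn; apply: (le_trans (ler_wpM2r _ IH)).
  by rewrite exprn_ge0// addr_ge0.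
rewrite mulrAC ler_wpM2r//.
have -> : n.+1%:R * (1 + n.+1%:R^-1) - 1 = n.+1%:R - 1 + 1 :> R.
  by rewrite mulrDr mulr1 divff ?pnatr_eq0//; lra.
rewrite [in leRHS]expRD ler_wpM2l ?expR_ge0//.
have -> : expR 1 = expR n.+1%:R^-1 ^+ n.+1 :> R.
  by rewrite -expRM_natl divff ?pnatr_eq0.
rewrite lerXn2r ?nnegrE ?expR_ge0 ?addr_ge0//.
exact: expR_ge1Dx.
Qed.

Lemma exp_taylor_le_expR (R : realType) (x : R) (n : nat) : 0 <= x ->
  \sum_(0 <= i < n) x ^+ i / i`!%:R <= expR x.
Proof.
move=> x0; rewrite /expR.
apply: (@nondecreasing_cvgn_le R (series (exp_coeff x))).
  by apply: nondecreasing_series => i _ _; rewrite divr_ge0 ?exprn_ge0.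
exact: is_cvg_series_exp_coeff.
Qed.

(** * Numerical bounds *)

Section numeric.
Variable R : realType.

Lemma expR1_ge : 2718 / 10 ^+ 3 <= expR 1 :> R.
Proof.
have := @exp_taylor_le_expR R 1 8 ler01.
rewrite !big_nat_recr ?big_geq //= !expr1n !factS fact0.
by lra.
Qed.

Lemma expR_seven_tenths_ge : 2012 / 10 ^+ 3 <= expR (7 / 10) :> R.
Proof.
have := @exp_taylor_le_expR R (7 / 10) 5 ltac:(lra).
rewrite !big_nat_recr ?big_geq //= !factS fact0.
by lra.
Qed.

Lemma expR_nat_ge n : (2718 / 10 ^+ 3) ^+ n <= expR (n%:R) :> R.
Proof.
have a0 : 0 <= 2718 / 10 ^+ 3 :> R by lra.
rewrite -(mulr1 n%:R) expRM_natl.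
by apply: lerXn2r; [exact: a0|exact: expR_ge0|exact: expR1_ge].
Qed.

Lemma expR_natD_ge n : (2718 / 10 ^+ 3) ^+ n * (2012 / 10 ^+ 3)
  <= expR (n%:R + 7 / 10) :> R.
Proof.
have a0 : 0 <= 2718 / 10 ^+ 3 :> R by lra.
have b0 : 0 <= 2012 / 10 ^+ 3 :> R by lra.
rewrite expRD.
apply: ler_pM; [exact: exprn_ge0|exact: b0|exact: expR_nat_ge|].
exact: expR_seven_tenths_ge.
Qed.

Lemma expR_geometric_ge k : 2 * 10 ^+ 3 * 100 ^+ k <= expR (8 * 2 ^+ k) :> R.
Proof.
have e8 : 2 * 10 ^+ 3 <= expR 8 :> R.
  by apply: (le_trans _ (expR_nat_ge 8)); lra.
elim: k => [|k IH]; first by rewrite !expr0 !mulr1.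
have -> : 2 * 10 ^+ 3 * 100 ^+ k.+1 = 2 * 10 ^+ 3 * 100 ^+ k * 100 :> R.
  by rewrite (exprSr 100 k) mulrA.
have -> : 8 * 2 ^+ k.+1 = 8 * 2 ^+ k + 8 * 2 ^+ k :> R.
  by rewrite (exprS 2 k); lra.
rewrite expRD; apply: ler_pM; [|lra|exact: IH|].
- apply: mulr_ge0; first by lra.
  by apply: exprn_ge0.
- apply: (@le_trans _ _ (expR 8)); first lra.
  by rewrite ler_expR ler_peMr// exprn_ege1// ler1n.
Qed.

(** 16002 = 8 * 2000 + 2 bounds ln(1/h)/h + 2 at the first mesh h = 1/2000. *)
Lemma first_entropy_le : expR 1 * (16 * 10 ^+ 3 + 2) <= expR (10 + 7042 / 10 ^+ 4) :> R.
Proof.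
have -> : 10 + 7042 / 10 ^+ 4 = 1 + (9 + 7 / 10 + 42 / 10 ^+ 4) :> R by lra.
rewrite [in leRHS]expRD ler_wpM2l ?expR_ge0//.
apply: (@le_trans _ _ (expR (9 + 7 / 10))); last by rewrite ler_expR; lra.
by apply: le_trans (expR_natD_ge 9); lra.
Qed.

(** 800 = 200 * 4: the base of the cover size grows by at most 200 per level, and
    a factor 4 is added so that the failure probabilities are summable. *)
Lemma expR_ge_800 : 800 <= expR (67 / 10) :> R.
Proof.
have -> : 67 / 10 = 6 + 7 / 10 :> R by lra.
by apply: le_trans (expR_natD_ge 6); lra.
Qed.
End numeric.

(** * Tails for sums of negatively dependent indicators *)

Lemma sum_set_prod (R : comNzRingType) (I : finType) (F : I -> R) :
  \sum_(u : {set I}) \prod_(i in u) F i = \prod_i (1 + F i).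
Proof.
under [RHS]eq_bigr do rewrite addrC.
rewrite bigA_distr; apply: eq_bigr => u _.
by rewrite [LHS]big_mkcond.
Qed.

Lemma sum_subset_expr (R : comNzRingType) (I : finType) (v : {set I}) (a : R) :
  \sum_(u : {set I} | u \subset v) a ^+ #|u| = (1 + a) ^+ #|v|.
Proof.
rewrite -prodr_const [RHS]big_mkcond/=.
rewrite (eq_bigr (fun i => 1 + (if i \in v then a else 0))); last first.
  by move=> i _; case: ifP; rewrite ?addr0.
rewrite -sum_set_prod big_mkcond/=; apply: eq_bigr => u _.
have [uv|] := boolP (u \subset v).
  rewrite -prodr_const; apply: eq_bigr => i iu.
  by rewrite (fintype.subsetP uv).
move=> /subsetPn[i iu iv]; rewrite (bigD1 i)//= (negbTE iv) mul0r//.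
Qed.

Section finite_valued.
Context {R : realType} {dO : measure_display} {Omega : measurableType dO}.
Variable P : probability Omega R.

Definition prob (A : set Omega) : R := fine (P A).

Lemma probE A : measurable A -> P A = (prob A)%:E.
Proof. by move=> mA; rewrite /prob fineK// fin_num_measure. Qed.

Lemma prob_ge0 A : 0 <= prob A.
Proof. by rewrite fine_ge0. Qed.

Variables (I : finType) (f : Omega -> I).
Hypothesis mf : forall i, measurable [set w | f w = i].

Let preimageE (Q : pred I) :
  [set w | Q (f w)] = \big[setU/set0]_(i | Q i) [set w | f w = i].
Proof.
rewrite -bigcup_seq_cond; apply/seteqP; split => w /=.
  by move=> Qw; exists (f w) => //=; rewrite mem_index_enum.
by move=> [i /= /andP[_ Qi] ->].
Qed.

Lemma measurable_finite_valued (Q : pred I) : measurable [set w | Q (f w)].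
Proof. by rewrite preimageE; apply: bigsetU_measurable. Qed.

Lemma prob_finite_valued (Q : pred I) :
  prob [set w | Q (f w)] = \sum_(i | Q i) prob [set w | f w = i].
Proof.
apply: EFin_inj; rewrite -probE; last exact: measurable_finite_valued.
rewrite -sumEFin; under [RHS]eq_bigr do rewrite -probE//.
rewrite (_ : [set w | Q (f w)] = \bigcup_(i in [set` Q]) [set w | f w = i]).
  rewrite measure_fin_bigcup//.
    by rewrite [RHS]bigfs// ?index_enum_uniq// => i _; rewrite mem_index_enum.
  by move=> i j _ _ [w /= [<- <-]].
apply/seteqP; split => w /=; first by move=> Qw; exists (f w).
by move=> [i /= Qi ->].
Qed.
End finite_valued.

Section chernoff.
Context {R : realType} {dO : measure_display} {Omega : measurableType dO}.
Variables (P : probability Omega R) (N : nat).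
Local Notation Pr := (prob P).

Section hits.
Variable T : 'I_N -> Omega -> bool.
Hypothesis mT : forall j, measurable [set w | T j w].

Definition hits (w : Omega) : {set 'I_N} := [set j | T j w]%SET.

Lemma measurable_hits (v : {set 'I_N}) : measurable [set w | hits w = v].
Proof.
rewrite (_ : mkset _ = \bigcap_(j in [set: 'I_N])
    (if j \in v then [set w | T j w] else ~` [set w | T j w])).
  apply: fin_bigcap_measurable => [|j _]; first exact: finite_finset.
  by case: ifP => _ //; exact: measurableC.
apply/seteqP; split => w /=.
  by move=> <- j _; rewrite inE; case: ifP => //= /negP.
move=> h; apply/setP => j; rewrite inE; have := h j I.
by case: ifP => //= _ /negP/negbTE.
Qed.

Lemma measurable_hits_pred (Q : pred {set 'I_N}) :
  measurable [set w | Q (hits w)].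
Proof. exact: measurable_finite_valued measurable_hits Q. Qed.

(** Markov's inequality for (1 + a)^(number of hits).  By the binomial identity
    this weight is the sum of a^#|u| over the sets u of indices that are all
    hit, so its expectation involves exactly the probabilities that negative
    dependence controls. *)
Lemma chernoff_hits (gamma p a r : R) (Q : pred {set 'I_N}) :
  0 <= a ->
  (forall u : {set 'I_N},
     Pr [set w | forall j, j \in u -> T j w] <= gamma * p ^+ #|u|) ->
  (forall v, Q v -> r <= (1 + a) ^+ #|v|) ->
  Pr [set w | Q (hits w)] * r <= gamma * (1 + p * a) ^+ N.
Proof.
move=> a0 dep Qr; rewrite (prob_finite_valued P measurable_hits) mulr_suml.
pose pv v := Pr [set w | hits w = v].
have pv0 v : 0 <= pv v by exact: prob_ge0.
have depE (u : {set 'I_N}) : Pr [set w | forall j, j \in u -> T j w] =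
    \sum_(v : {set 'I_N} | u \subset v) pv v.
  rewrite -(prob_finite_valued P measurable_hits (fun v => u \subset v)).
  congr prob; apply/seteqP; split => w; rewrite /mkset.
    by move=> h; apply/fintype.subsetP => j /h; rewrite inE.
  by move=> /fintype.subsetP h j /h; rewrite inE.
apply: (@le_trans _ _ (\sum_v pv v * (1 + a) ^+ #|v|)).
  rewrite big_mkcond; apply: ler_sum => v _; case: ifP => [Qv|_].
    by apply: ler_wpM2l; [exact: pv0|exact: Qr].
  by rewrite mulr_ge0// exprn_ge0// addr_ge0.
under eq_bigr do rewrite -sum_subset_expr mulr_sumr big_mkcond/=.
rewrite exchange_big/=.
have -> : (1 + p * a) ^+ N = \sum_(u : {set 'I_N}) (p * a) ^+ #|u|.
  under [RHS]eq_bigr do rewrite -prodr_const.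
  by rewrite sum_set_prod prodr_const card_ord.
rewrite mulr_sumr; apply: ler_sum => u _.
rewrite -big_mkcond -mulr_suml -depE exprMn mulrA.
by rewrite ler_wpM2r// exprn_ge0.
Qed.

End hits.

(** The parameter psi bounds the logarithmic moment generating function at l of
    the centred indicator and of its negative; the lower tail is the upper tail
    of the complementary indicators, whose success probability is 1 - p. *)
Lemma two_sided_tail (T : 'I_N -> Omega -> bool) (gamma p t l psi : R) :
  (0 < N)%N -> (forall j, measurable [set w | T j w]) -> 0 <= l ->
  (forall u : {set 'I_N},
     Pr [set w | forall j, j \in u -> T j w] <= gamma * p ^+ #|u|) ->
  (forall u : {set 'I_N},
     Pr [set w | forall j, j \in u -> ~~ T j w] <= gamma * (1 - p) ^+ #|u|) ->
  1 + p * (expR l - 1) <= expR (p * l + psi) ->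
  1 + (1 - p) * (expR l - 1) <= expR ((1 - p) * l + psi) ->
  0 <= p <= 1 -> 0 <= gamma ->
  Pr [set w | t < `| #|hits T w|%:R / N%:R - p | ]
    <= 2 * gamma * expR (- (N%:R * (l * t - psi))).
Proof.
move=> N0 mT l0 dep1 dep0 mgf1 mgf0 /andP[p0 p1] g0.
have NR : 0 < N%:R :> R by rewrite ltr0n.
have one_sided (S : 'I_N -> Omega -> bool) (q : R) :
    (forall j, measurable [set w | S j w]) -> 0 <= q ->
    (forall u : {set 'I_N},
     Pr [set w | forall j, j \in u -> S j w] <= gamma * q ^+ #|u|) ->
    1 + q * (expR l - 1) <= expR (q * l + psi) ->
    Pr [set w | t < #|hits S w|%:R / N%:R - q]
      <= gamma * expR (- (N%:R * (l * t - psi))).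
  move=> mS q0 dep mgf.
  pose r := expR (N%:R * (l * (q + t))).
  have := @chernoff_hits S mS gamma q (expR l - 1) r
    (fun v => t < #|v|%:R / N%:R - q).
  have -> : 1 + (expR l - 1) = expR l by lra.
  have l1 : 0 <= expR l - 1 by rewrite subr_ge0 -expR0 ler_expR.
  move=> /(_ l1 dep) H; rewrite -(ler_pM2r (expR_gt0 (N%:R * (l * (q + t))))).
  apply: (le_trans (H _)).
    move=> v; rewrite ltrBrDl ltr_pdivlMr// => h.
    rewrite /r -expRM_natl ler_expR.
    have -> : N%:R * (l * (q + t)) = (q + t) * N%:R * l by ring.
    exact: ler_wpM2r (ltW h).
  rewrite -mulrA -expRD ler_wpM2l//.
  have -> : - (N%:R * (l * t - psi)) + N%:R * (l * (q + t)) = N%:R * (q * l + psi).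
    by ring.
  rewrite expRM_natl lerXn2r// nnegrE ?expR_ge0//.
  by rewrite addr_ge0// mulr_ge0.
have cardC w : #|hits (fun j w => ~~ T j w) w|%:R = N%:R - #|hits T w|%:R :> R.
  rewrite (_ : hits _ w = ~: hits T w)%SET; last by apply/setP => j; rewrite !inE.
  by rewrite cardsCs finset.setCK card_ord natrB// -[X in (_ <= X)%N]card_ord max_card.
have mTC j : measurable [set w | ~~ T j w].
  rewrite (_ : mkset _ = ~` [set w | T j w]); first exact: measurableC.
  by apply/seteqP; split => w /= /negP.
have up := one_sided T p mT p0 dep1 mgf1.
have q0 : 0 <= 1 - p by rewrite subr_ge0.
have lo := one_sided _ (1 - p) mTC q0 dep0 mgf0.
have -> : [set w | t < `| #|hits T w|%:R / N%:R - p | ] =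
   [set w | t < #|hits T w|%:R / N%:R - p] `|`
   [set w | t < #|hits (fun j w => ~~ T j w) w|%:R / N%:R - (1 - p)].
  have E w : #|hits (fun j w => ~~ T j w) w|%:R / N%:R - (1 - p) =
     - (#|hits T w|%:R / N%:R - p).
    by rewrite cardC mulrBl divff ?gt_eqF//; ring.
  apply/seteqP; split => w /=; rewrite E lter_normr/= => /orP//.
set A := mkset _; set B := mkset _.
have mA : measurable A.
  exact: (@measurable_hits_pred T mT (fun v => t < #|v|%:R / N%:R - p)).
have mB : measurable B.
  exact: (@measurable_hits_pred _ mTC (fun v => t < #|v|%:R / N%:R - (1 - p))).
rewrite -mulrA mulr_natl mulr2n; apply: le_trans (lerD up lo).
rewrite -lee_fin EFinD -!probE//; last exact: measurableU.
exact: measureU2.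
Qed.

End chernoff.

Section negative_dependence_tails.
Context {R : realType} {dO : measure_display} {Omega : measurableType dO}.
Variables (P : probability Omega R) (N : nat).
Local Notation Pr := (prob P).
Variables (T : 'I_N -> Omega -> bool) (gamma p : R).
Hypotheses (N0 : (0 < N)%N) (g0 : 0 <= gamma).
Hypothesis mT : forall j, measurable [set w | T j w].
Hypothesis Tp : forall j, P [set w | T j w = true] = p%:E.
Hypothesis Tdep : negatively_dependent P gamma T.

Let TpC j : P [set w | T j w = false] = (1 - p)%:E.
Proof.
rewrite (_ : mkset _ = ~` [set w | T j w = true]).
  have mTj : measurable [set w | T j w = true] := mT j.
  by rewrite probability_setC// (Tp j).
by apply/seteqP; split => w /=; [move=> ->|move=> /negP/negbTE].
Qed.

Let p01 : 0 <= p <= 1.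
Proof.
have j : 'I_N by exact: Ordinal N0.
rewrite -!lee_fin -(Tp j); apply/andP; split; first exact: measure_ge0.
by apply: probability_le1; exact: mT.
Qed.

Let mall (S : 'I_N -> Omega -> bool) (u : {set 'I_N}) :
  (forall j, measurable [set w | S j w]) ->
  measurable [set w | forall j, j \in u -> S j w].
Proof.
move=> mS; rewrite (_ : mkset _ = \bigcap_(j in [set` u]) [set w | S j w])//.
by apply: fin_bigcap_measurable => [|j _]; first exact: finite_finset.
Qed.

Let dep1 (u : {set 'I_N}) :
  Pr [set w | forall j, j \in u -> T j w] <= gamma * p ^+ #|u|.
Proof.
have [+ _] := Tdep u; under eq_bigr do rewrite Tp.
rewrite -lee_fin -probE; last exact: mall.
by rewrite prodEFin prodr_const -EFinM.
Qed.

Let mTC j : measurable [set w | ~~ T j w].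
Proof.
rewrite (_ : mkset _ = ~` [set w | T j w]); first exact: measurableC.
by apply/seteqP; split => w /= /negP.
Qed.

Let dep0 (u : {set 'I_N}) :
  Pr [set w | forall j, j \in u -> ~~ T j w] <= gamma * (1 - p) ^+ #|u|.
Proof.
have [_ +] := Tdep u; under eq_bigr do rewrite TpC.
rewrite -lee_fin -probE; last exact: (@mall (fun j w => ~~ T j w)).
rewrite prodEFin prodr_const -EFinM.
rewrite (_ : [set w | forall j, j \in u -> ~~ T j w] =
             [set w | forall j, j \in u -> T j w = false])//.
by apply/seteqP; split => w h j /h /=; [move/negbTE|move=> ->].
Qed.

Lemma hoeffding_negatively_dependent (t : R) : 0 <= t ->
  Pr [set w | t < `| #|hits T w|%:R / N%:R - p | ]
    <= 2 * gamma * expR (- (N%:R * (2 * t ^+ 2))).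
Proof.
move=> t0; have /andP[p0 p1] := p01.
(* l = 4 t maximizes l t - l^2 / 8 *)
have l0 : 0 <= 4 * t by lra.
have -> : 2 * t ^+ 2 = 4 * t * t - (4 * t) ^+ 2 / 8 by lra.
apply: two_sided_tail => //; apply: hoeffding_bernoulli => //; lra.
Qed.

(** A variance-sensitive tail: the variance of each indicator is at most delta.
    For t <= delta the optimal parameter t / (2 delta) is at most 1/2, where the
    exponential is bounded by 1 + x + x^2. *)
Lemma bernstein_negatively_dependent (t delta : R) :
  0 < delta -> p <= delta -> 0 <= t <= delta ->
  Pr [set w | t < `| #|hits T w|%:R / N%:R - p | ]
    <= 2 * gamma * expR (- (N%:R * (t ^+ 2 / (4 * delta)))).
Proof.
move=> d0 pd /andP[t0 td]; have /andP[p0 p1] := p01.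
pose l := t / (2 * delta).
have l0 : 0 <= l by rewrite divr_ge0// mulr_ge0// ltW.
have l2 : l <= 1 / 2 by rewrite ler_pdivrMr ?mulr_gt0//; lra.
have -> : t ^+ 2 / (4 * delta) = l * t - delta * l ^+ 2.
  by rewrite /l; field; rewrite gt_eqF.
have q0 (x : R) : `|x| <= 1 / 2 -> 1 + p * (expR x - 1) <= expR (p * x + delta * x ^+ 2).
  move=> /expR_quadratic hx; apply: le_trans (expR_ge1Dx _).
  rewrite lerD2l; apply: (@le_trans _ _ (p * (x + x ^+ 2))).
    by rewrite ler_wpM2l//; lra.
  by rewrite mulrDr lerD2l ler_wpM2r// sqr_ge0.
have l2n : `|l| <= 1 / 2 by rewrite ger0_norm.
apply: two_sided_tail => //; first exact: q0.
have -> : 1 + (1 - p) * (expR l - 1) = expR l * (1 + p * (expR (- l) - 1)).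
  by rewrite !(mulrBr, mulrDr) !(mulrCA (expR l) p) expRxMexpNx_1; ring.
have -> : (1 - p) * l + delta * l ^+ 2 = l + (p * (- l) + delta * (- l) ^+ 2).
  by ring.
by rewrite expRD ler_wpM2l ?expR_ge0// q0// normrN.
Qed.

End negative_dependence_tails.

(** * Bracketing covers of the anchored boxes *)

(** Truncating a sequence greedily to a total of L; used to lower exponents until
    their sum is exactly L. *)
Lemma sum_greedy_truncation (i : nat -> nat) (L n : nat) :
  (\sum_(k < n) minn (i k) (L - \sum_(l < k) i l) = minn (\sum_(k < n) i k) L)%N.
Proof.
elim: n => [|n IH]; first by rewrite !big_ord0 min0n.
by rewrite !big_ord_recr/= IH; move: (\sum_(k < n) i k)%N (i n) => S m; lia.
Qed.

Lemma ler_bin_expR (R : realType) (n m : nat) : (0 < m)%N ->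
  'C(n, m)%:R <= expR (m%:R - 1) * (n%:R / m%:R) ^+ m :> R.
Proof.
move=> m0; have f0 : 0 < m`!%:R :> R by rewrite ltr0n fact_gt0.
have mR : 0 < m%:R :> R by rewrite ltr0n.
rewrite -(ler_pM2r f0) -natrM bin_ffact.
apply: (@le_trans _ _ (n%:R ^+ m)).
  rewrite -natrX ler_nat ffact_prod -[X in (_ <= _ ^ X)%N]card_ord -prod_nat_const.
  by apply: leq_prod => i _; rewrite leq_subr.
rewrite mulrAC expr_div_n mulrA ler_pdivlMr ?exprn_gt0//.
rewrite [leRHS]mulrC ler_wpM2l ?exprn_ge0//; last exact: ler1_fact.
Qed.

Local Notation origin := Defs.tuple0.

Section cover.
Context {R : realType} {d : nat}.
Implicit Types (x y v w : d.-tuple R).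

Definition volume x : R := \prod_(j < d) tnth x j.

Definition grid_point (a : R) (e : nat -> nat) : d.-tuple R :=
  [tuple expR (- (a * (e j)%:R)) | j < d].

(** Exponents are indexed by tuples over 'I_M.+1 so that the grid is counted by
    the number of partial ordered partitions of M. *)
Definition grid (a : R) (M : nat) : seq (d.-tuple R) :=
  [seq grid_point a (fun j => nth ord0 (val t) j) |
    t <- enum [set t : d.-tuple 'I_M.+1 | (\sum_(i <- t) i <= M)%N]%SET].

Lemma size_grid a M : size (grid a M) = 'C(d + M, d).
Proof. by rewrite size_map -cardE card_partial_ord_partitions. Qed.

Lemma eq_grid_point a (e e' : nat -> nat) : (forall j : 'I_d, e j = e' j) ->
  grid_point a e = grid_point a e'.
Proof. by move=> ee'; apply/eq_mktuple => j; rewrite ee'. Qed.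

Lemma grid_point_in a M (e : nat -> nat) : (\sum_(j < d) e j <= M)%N ->
  grid_point a e \in grid a M.
Proof.
move=> eM; apply/mapP.
have eleM (j : 'I_d) : (e j <= M)%N.
  by apply: leq_trans eM; rewrite (bigD1 j)//= leq_addr.
exists [tuple inord (e j) | j < d].
  rewrite mem_enum inE big_tuple; under eq_bigr do rewrite tnth_mktuple inordK ?ltnS//.
  exact: eM.
apply: eq_grid_point => j.
by rewrite -tnth_nth tnth_mktuple inordK ?ltnS.
Qed.

Lemma grid_in_closed_cube a M x : 0 <= a -> x \in grid a M -> closed_cube x.
Proof.
move=> a0 /mapP[t _ ->] j; rewrite tnth_mktuple expR_ge0 -expR0 ler_expR.
by rewrite oppr_le0 mulr_ge0.
Qed.

Lemma volume_grid_point a (e : nat -> nat) :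
  volume (grid_point a e) = expR (- (a * (\sum_(j < d) e j)%:R)).
Proof.
rewrite /volume natr_sum mulr_sumr -sumrN expR_sum.
by apply: eq_bigr => j _; rewrite tnth_mktuple.
Qed.

Lemma volume_origin : (0 < d)%N -> volume origin = 0.
Proof.
by move=> d0; rewrite /volume (bigD1 (Ordinal d0))//= tnth_mktuple mul0r.
Qed.

(** Put a = h/d, so that raising all d exponents by one multiplies the volume by
    exp(-h), and hence changes it by at most h.  For each coordinate of y take
    the largest exponent that keeps the grid point above y.  If the exponents
    add up to less than L, the upper bracket w is this grid point and the lower
    bracket has all exponents raised by one.  Otherwise lower the exponents to a
    total of exactly L, where the volume has dropped to at most h, and the origin
    serves as lower bracket.  B stands for an upper bound on ln(1/h). *)
Lemma bracketing_cover (h B : R) :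
  (0 < d)%N -> 0 < h -> 0 <= B -> expR (- B) <= h ->
  exists s : seq (d.-tuple R),
  [/\ (size s)%:R <= expR (-1) * (expR 1 * (B / h + 2)) ^+ d,
      forall x, x \in s -> closed_cube x &
      forall y, closed_cube y -> exists v w,
        [/\ v \in origin :: s, w \in s,
            forall j, tnth v j <= tnth y j <= tnth w j &
            volume w - volume v <= h]].
Proof.
move=> d0 h0 B0 Bh.
have dR : 0 < d%:R :> R by rewrite ltr0n.
have dBh0 : 0 <= d%:R * B / h by rewrite !mulr_ge0// invr_ge0 ltW.
have [L [L0 Lub Llb]] : exists L : nat,
    [/\ (0 < L)%N, L.-1%:R <= d%:R * B / h & d%:R * B / h <= L%:R].
  exists (Num.truncn (d%:R * B / h)).+1; split => //; first by rewrite truncn_le.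
  by apply/ltW; rewrite truncnS_gt.
pose a := h / d%:R.
have a0 : 0 < a by rewrite divr_gt0.
have aL : expR (- (a * L%:R)) <= h.
  apply: le_trans Bh; rewrite ler_expR lerN2.
  apply: (@le_trans _ _ (a * (d%:R * B / h))); last by rewrite ler_pM2l.
  rewrite le_eqVlt; apply/orP; left; apply/eqP; rewrite /a; field.
  by rewrite !gt_eqF.
(* the lower brackets have exponent sum at most (L - 1) + d *)
pose M := (L + d).-1.
exists (grid a M); split.
- rewrite size_grid; apply: (le_trans (ler_bin_expR _ _ d0)).
  rewrite addrC expRD -mulrA ler_wpM2l ?expR_ge0//.
  rewrite [leRHS]exprMn -expRM_natl mulr1 ler_wpM2l ?expR_ge0//.
  have Bh0 : 0 <= B / h by rewrite divr_ge0// ltW.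
  apply: lerXn2r; [by rewrite nnegrE divr_ge0|by rewrite nnegrE addr_ge0|].
  rewrite ler_pdivrMr//.
  have -> : (B / h + 2) * d%:R = d%:R * B / h + d%:R + d%:R by ring.
  have -> : (d + M)%N = (L.-1 + d + d)%N by rewrite /M; lia.
  by rewrite !natrD !lerD2r.
- by move=> x; apply: grid_in_closed_cube; exact: ltW.
move=> y cy.
pose good z (i : nat) := z <= expR (- (a * i%:R)).
(* capped at L, so that z = 0 causes no trouble *)
pose ex z : nat := [arg max_(i > ord0 : 'I_L.+1 | good z i) i].
have exP z : z <= 1 -> [/\ good z (ex z), (ex z <= L)%N &
    forall k, (k <= L)%N -> good z k -> (k <= ex z)%N].
  move=> z1; rewrite /ex; case: arg_maxnP.
    by rewrite /good /= mulr0 oppr0 expR0.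
  move=> i gi imax; split=> //; first by rewrite -ltnS.
  by move=> k kL gk; apply: (imax (Ordinal (kL : (k < L.+1)%N))).
pose e j := ex (nth 0 y j).
have eP (j : 'I_d) : [/\ good (tnth y j) (e j), (e j <= L)%N &
    forall k, (k <= L)%N -> good (tnth y j) k -> (k <= e j)%N].
  by rewrite /e -tnth_nth; apply: exP; have /andP[] := cy j.
have [Le|eL] := leqP L (\sum_(j < d) e j)%N.
  pose e' j := minn (e j) (L - \sum_(l < j) e l)%N.
  have e'L : (\sum_(j < d) e' j)%N = L.
    by rewrite /e' sum_greedy_truncation; apply/minn_idPr.
  exists origin, (grid_point a e'); split.
  - exact: mem_head.
  - by apply: grid_point_in; rewrite e'L /M; lia.
  - move=> j; rewrite !tnth_mktuple; have /andP[-> _]/= := cy j.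
    have [gj _ _] := eP j; apply: (le_trans gj).
    by rewrite ler_expR lerN2 ler_pM2l// ler_nat geq_minl.
  by rewrite volume_grid_point e'L volume_origin// subr0.
exists (grid_point a (fun j => (e j).+1)), (grid_point a e).
have eS : (\sum_(j < d) (e j).+1 = \sum_(j < d) e j + d)%N.
  under eq_bigr do rewrite -addn1.
  by rewrite big_split/= sum_nat_const card_ord muln1.
split.
- by rewrite inE grid_point_in ?orbT// eS /M; lia.
- by apply: grid_point_in; rewrite /M; lia.
- move=> j; rewrite !tnth_mktuple; have [gj _ jmax] := eP j; rewrite andbC.
  apply/andP; split; first exact: gj.
  have ejL : (e j < L)%N by apply: leq_ltn_trans eL; rewrite (bigD1 j)//= leq_addr.
  by rewrite leNgt; apply/negP => /ltW /(jmax _ ejL); rewrite ltnn.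
rewrite !volume_grid_point eS natrD mulrDr opprD expRD.
set V := expR (- _); have V1 : V <= 1.
  by rewrite -expR0 ler_expR oppr_le0 mulr_ge0// ltW.
have -> : a * d%:R = h by rewrite /a divfK// gt_eqF.
have := expR_ge1Dx (- h); have := expR_ge0 (- (a * (\sum_(j < d) e j)%:R)).
rewrite -/V; set X := expR (- h) => V0 Xh.
have : V * (1 - X) <= 1 * h.
  by apply: (@le_trans _ _ (V * h)); [rewrite ler_wpM2l//; lra|rewrite ler_pM2r].
lra.
Qed.
End cover.

(** * Local discrepancy and chaining *)

Section local_discrepancy.
Context {R : realType} {d : nat}.
Implicit Types (x y v w : d.-tuple R).

Definition corner_le x y := forall j, tnth x j <= tnth y j.

Lemma origin_le x : closed_cube x -> corner_le origin x.
Proof. by move=> cx j; rewrite tnth_mktuple; have /andP[] := cx j. Qed.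

Lemma closed_cube_origin : closed_cube (origin : d.-tuple R).
Proof. by move=> j; rewrite tnth_mktuple lexx ler01. Qed.

Lemma volume_le v x : closed_cube v -> corner_le v x -> volume v <= volume x.
Proof.
by move=> cv vx; apply: ler_prod => j _; rewrite vx andbT; have /andP[] := cv j.
Qed.

Lemma volume01 x : closed_cube x -> 0 <= volume x <= 1.
Proof.
move=> cx; apply/andP; split.
  by apply: prodr_ge0 => j _; have /andP[] := cx j.
rewrite -[leRHS](@big1 R 1 *%R 'I_d (index_enum _) xpredT (fun=> 1))//.
by apply: ler_prod => j _; exact: cx.
Qed.

Lemma lebesgue_anchored_box x : closed_cube x ->
  lebesgue_measure_tuple d (box origin x) = (volume x)%:E.
Proof.
move=> cx; rewrite lebesgue_measure_tuple_box; last exact: origin_le.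
by congr EFin; apply: eq_bigr => j _; rewrite tnth_mktuple subr0.
Qed.

Lemma box_le v x : corner_le v x -> box origin v `<=` box origin x.
Proof.
move=> vx z zv j; have /andP[-> h] := zv j; exact: lt_le_trans h (vx j).
Qed.

Lemma box_origin : (0 < d)%N -> box origin origin = set0 :> set (d.-tuple R).
Proof.
move=> d0; apply/seteqP; split => // z /(_ (Ordinal d0)).
by rewrite /= tnth_mktuple => /andP[/le_lt_trans h /h]; rewrite ltxx.
Qed.

Lemma lebesgue_box_difference v x :
  closed_cube v -> closed_cube x -> corner_le v x ->
  lebesgue_measure_tuple d ((box origin x `\` box origin v) `&` half_open_cube)
    = (volume x - volume v)%:E.
Proof.
move=> cv cx vx; rewrite setIidl; last first.
  move=> z [zx _] j; have /andP[] := zx j; rewrite tnth_mktuple => -> h.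
  by apply: lt_le_trans h _; have /andP[] := cx j.
rewrite measureD; [|exact: measurable_box|exact: measurable_box|].
  rewrite setIidr; last exact: box_le.
  by rewrite EFinB; congr (_ - _)%E; exact: lebesgue_anchored_box.
have := ltry (volume x); rewrite -(lebesgue_anchored_box cx); exact.
Qed.

Section point_set.
Variables (N : nat) (p : 'I_N -> d.-tuple R).

Definition local_discrepancy x : R :=
  #|[pred i | p i \in box origin x]|%:R / N%:R - volume x.

Lemma discrepancyE x : closed_cube x ->
  discrepancy p (box origin x) = `| local_discrepancy x |.
Proof. by move=> cx; rewrite /discrepancy lebesgue_anchored_box. Qed.

Lemma local_discrepancy_origin : (0 < d)%N -> local_discrepancy origin = 0.
Proof.
move=> d0; rewrite /local_discrepancy volume_origin// box_origin// subr0.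
rewrite (eq_card0 (A := [pred i | p i \in set0])) ?mul0r// => i.
by apply/negbTE/negP; rewrite !inE.
Qed.

Lemma local_discrepancy_bracket v y w h :
  closed_cube v -> corner_le v y -> corner_le y w ->
  volume w - volume v <= h ->
  local_discrepancy v - h <= local_discrepancy y <= local_discrepancy w + h.
Proof.
move=> cv vy yw vh.
have cnt x z : corner_le x z ->
    #|[pred i | p i \in box origin x]|%:R / N%:R
    <= #|[pred i | p i \in box origin z]|%:R / N%:R :> R.
  move=> xz; rewrite ler_wpM2r// ler_nat; apply: subset_leq_card.
  by apply/fintype.subsetP => i; rewrite !inE => /box_le; exact.
have := cnt _ _ vy; have := cnt _ _ yw.
have := volume_le cv vy.
have cy0 : forall j, 0 <= tnth y j.
  by move=> j; apply: le_trans (vy j); have /andP[] := cv j.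
have : volume y <= volume w by apply: ler_prod => j _; rewrite cy0 yw.
rewrite /local_discrepancy; lra.
Qed.

Lemma local_discrepancyB v x : corner_le v x ->
  local_discrepancy x - local_discrepancy v =
  #|[set i | p i \in box origin x `\` box origin v]%SET|%:R / N%:R
    - (volume x - volume v).
Proof.
move=> vx; rewrite /local_discrepancy.
have -> : #|[pred i | p i \in box origin x]| =
    (#|[set i | p i \in box origin x `\` box origin v]%SET|
      + #|[pred i | p i \in box origin v]|)%N.
  pose X := [set i | p i \in box origin x]%SET.
  pose B := [set i | p i \in box origin v]%SET.
  have memX i : (i \in X) = (p i \in box origin x) by rewrite finset.in_set.
  have memB i : (i \in B) = (p i \in box origin v) by rewrite finset.in_set.
  have -> : #|[pred i | p i \in box origin x]| = #|X|.
    by apply: eq_card => i; rewrite memX.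
  have -> : #|[pred i | p i \in box origin v]| = #|X :&: B|.
    apply: eq_card => i; rewrite finset.in_setI memX memB -topredE/=.
    have [iv|iv] := boolP (p i \in box origin v); last by rewrite andbF.
    by rewrite andbT; apply/esym/mem_set/(box_le vx)/set_mem.
  rewrite -[LHS](cardsID B X) addnC; congr (_ + _)%N.
  apply: eq_card => i; rewrite finset.in_setD finset.in_set memX memB.
  by rewrite in_setD andbC.
by rewrite natrD mulrDl; ring.
Qed.

Lemma star_discrepancy_le t : star_discrepancy p <= t <->
  forall y, closed_cube y -> `| local_discrepancy y | <= t.
Proof.
rewrite /star_discrepancy; split.
  move=> st y cy; rewrite -discrepancyE//; apply: le_trans st.
  apply: ub_le_sup; last by exists y.
  exists 2 => _ [z cz <-]; rewrite discrepancyE//.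
  have /andP[v0 v1] := volume01 cz.
  have c0 : 0 <= #|[pred i | p i \in box origin z]|%:R / N%:R :> R.
    by rewrite divr_ge0.
  have c1 : #|[pred i | p i \in box origin z]|%:R / N%:R <= 1 :> R.
    have [N0|N0] := posnP N.
      by rewrite [X in _ / X](_ : _ = 0) ?invr0 ?mulr0// N0.
    rewrite ler_pdivrMr ?ltr0n// mul1r ler_nat.
    by rewrite -[leqRHS]card_ord max_card.
  by rewrite /local_discrepancy ler_norml; lra.
move=> h; apply: ge_sup.
  exists (discrepancy p (box origin origin)); exists origin => //.
  exact: closed_cube_origin.
by move=> _ [y cy <-]; rewrite discrepancyE// h.
Qed.

(** Telescoping from a corner of level k down through lower brackets to the
    origin, whose box is empty; the last cover is used on both sides of y. *)
Lemma chaining (s : nat -> seq (d.-tuple R)) (lo up : nat -> d.-tuple R -> d.-tuple R)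
    (t delta : nat -> R) (K : nat) :
  (0 < d)%N ->
  (forall k, 0 <= t k) ->
  (forall k x, x \in s k -> closed_cube x) ->
  (forall k y, closed_cube y ->
    [/\ lo k y \in origin :: s k, up k y \in s k,
        forall j, tnth (lo k y) j <= tnth y j <= tnth (up k y) j &
        volume (up k y) - volume (lo k y) <= delta k]) ->
  (forall k x, (k <= K)%N -> x \in s k ->
    `| local_discrepancy x -
       local_discrepancy (if k is k'.+1 then lo k' x else origin) | <= t k) ->
  forall y, closed_cube y ->
    `| local_discrepancy y | <= \sum_(k < K.+1) t k + delta K.
Proof.
move=> d0 t0 scube cov incr.
have locube k y : closed_cube y -> closed_cube (lo k y).
  move=> cy; have [+ _ _ _] := cov k y cy.
  by rewrite inE => /orP[/eqP->|/scube//]; exact: closed_cube_origin.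
have chain k x : (k <= K)%N -> x \in origin :: s k ->
    `| local_discrepancy x | <= \sum_(i < k.+1) t i.
  elim: k x => [|k IH] x kK.
    rewrite inE => /orP[/eqP->|xs].
      by rewrite local_discrepancy_origin// normr0 sumr_ge0.
    have := incr 0 x kK xs.
    by rewrite local_discrepancy_origin// subr0 big_ord1.
  rewrite inE => /orP[/eqP->|xs].
    by rewrite local_discrepancy_origin// normr0 sumr_ge0.
  have [los _ _ _] := cov k x (scube _ _ xs).
  rewrite big_ord_recr/= -[local_discrepancy x](subrK (local_discrepancy (lo k x))).
  rewrite [leRHS]addrC; apply: (le_trans (ler_normD _ _)); apply: lerD.
    exact: (incr k.+1).
  by apply: IH los; exact: ltnW.
move=> y cy; have [los ups lou dl] := cov K y cy.
have ly : corner_le (lo K y) y by move=> j; have /andP[] := lou j.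
have yu : corner_le y (up K y) by move=> j; have /andP[] := lou j.
have := chain K _ (leqnn K) los.
have ups' : up K y \in origin :: s K by rewrite inE ups orbT.
have := chain K _ (leqnn K) ups'.
have := local_discrepancy_bracket (locube _ _ cy) ly yu dl.
rewrite !ler_norml; lra.
Qed.

End point_set.
End local_discrepancy.

(** * Parameters of the chain *)

Section mesh.
Variable R : realType.

(** In the bound exp(-(rate c^2 - entropy - rho) d), rate c^2 d is the exponent
    of Hoeffding's bound at level 0, and entropy d bounds the logarithm of the
    size of the cover at that level. *)
Definition rate : R := 1 + 6741 / 10 ^+ 4.

Definition entropy : R := 10 + 7042 / 10 ^+ 4.

Definition mesh (k : nat) : R := (2 * 10 ^+ 3 * 100 ^+ k)^-1.

(** An upper bound on ln (1 / mesh k) that is generous for large k but keeps the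
    cover sizes geometric. *)
Definition log_mesh (k : nat) : R := 8 * 2 ^+ k.

(** The fraction of the total deviation that is allotted to level k. *)
Definition weight (k : nat) : R :=
  if k is k'.+1 then 74 / 10 ^+ 3 / 8 ^+ k' else 915 / 10 ^+ 3.

Lemma mesh_gt0 k : 0 < mesh k.
Proof. by rewrite invr_gt0; apply: mulr_gt0; [lra|exact: exprn_gt0]. Qed.

Lemma expRN_log_mesh k : expR (- log_mesh k) <= mesh k.
Proof.
rewrite expRN lef_pV2 ?posrE ?expR_gt0//; exact: expR_geometric_ge.
Qed.

Lemma weight_ge0 k : 0 <= weight k.
Proof.
case: k => [|k] /=; first lra.
by apply: divr_ge0; [lra|exact: exprn_ge0].
Qed.

Lemma sum_weight K : \sum_(k < K) weight k <= 1.
Proof.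
case: K => [|K]; first by rewrite big_ord0.
rewrite big_ord_recl /=.
have -> : \sum_(k < K) weight (bump 0 k) =
    74 / 10 ^+ 3 * (8 / 7 * (1 - 8^-1 ^+ K)).
  elim: K => [|K IH]; first by rewrite big_ord0 expr0 subrr !mulr0.
  rewrite big_ord_recr /= IH -(exprVn 8 K) (exprS 8^-1 K).
  by move: (8^-1 ^+ K) => x; lra.
have : 0 <= 8^-1 ^+ K :> R by rewrite exprn_ge0// invr_ge0.
by move: (8^-1 ^+ K) => x; lra.
Qed.

(** The last level K is the first whose mesh is at most the deviation allowed at
    level K + 1.  Minimality gives, at all earlier levels, that the deviation is
    at most the variance bound, as the Bernstein tail requires. *)
Lemma exists_last_level (T : R) : 0 < T ->
  exists K, mesh K <= weight K.+1 * T /\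
    forall k, (k < K)%N -> weight k.+1 * T <= mesh k.
Proof.
move=> T0.
have ex : exists K, mesh K <= weight K.+1 * T.
  exists (Num.truncn (100 * T)^-1).+1; set n := _.+1.
  have : (100 * T)^-1 < n%:R by exact: truncnS_gt.
  move=> h; have hn : n%:R <= (100 / 8) ^+ n :> R.
    apply: (@le_trans _ _ (2 ^+ n)); first by rewrite -natrX ler_nat ltnW// ltn_expl.
    by apply: lerXn2r; rewrite ?nnegrE//; lra.
  have {}h : (100 * T)^-1 <= (100 / 8) ^+ n by apply: le_trans hn; exact: ltW.
  have T100 : 0 < 100 * T by rewrite mulr_gt0.
  rewrite -[X in X <= _]mul1r ler_pdivrMr; last by rewrite -invr_gt0 mesh_gt0.
  move: h; rewrite -[X in X <= _]mul1r ler_pdivrMr// expr_div_n /= => h.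
  have -> : 74 / 10 ^+ 3 / 8 ^+ n * T * (2 * 10 ^+ 3 * 100 ^+ n) =
     100 ^+ n / 8 ^+ n * (100 * T) * (148 / 100) :> R.
    by move: (100 ^+ n) ((8 ^+ n)^-1) => x y; lra.
  by move: h; move: (100 ^+ n / 8 ^+ n * (100 * T)) => z; lra.
case: (ex_minnP ex) => K hK Kmin; exists K; split => // k kK.
by rewrite leNgt; apply/negP => /ltW /Kmin; rewrite leqNgt kK.
Qed.

(** The summability factor 4^(-k) is extracted already here, since d >= 1 allows
    one to trade (200^k)^d for 4^(-k) (800^k)^d. *)
Lemma cover_size_bound (d k n : nat) : (0 < d)%N ->
  n%:R <= expR (-1) * (expR 1 * (log_mesh k / mesh k + 2)) ^+ d :> R ->
  n%:R <= expR (-1) * 4^-1 ^+ k *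
    expR ((entropy + 67 / 10 * k%:R) * d%:R) :> R.
Proof.
move=> d0 /le_trans; apply; rewrite -mulrA ler_wpM2l ?expR_ge0//.
rewrite (exprVn 4 k) ler_pdivlMl; last exact: exprn_gt0.
have k4 : 4 ^+ k <= (4 ^+ k) ^+ d :> R.
  by rewrite -[leLHS]expr1 ler_weXn2l// exprn_ege1// ler1n.
rewrite expRM_natr.
have q0 : 0 <= expR 1 * (log_mesh k / mesh k + 2).
  apply: mulr_ge0; first exact: expR_ge0.
  apply: addr_ge0 => //; apply: divr_ge0; last exact/ltW/mesh_gt0.
  by apply: mulr_ge0 => //; exact: exprn_ge0.
apply: (le_trans (ler_wpM2r (exprn_ge0 _ q0) k4)).
have k40 : 0 <= 4 ^+ k :> R by exact: exprn_ge0.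
rewrite -exprMn; apply: lerXn2r; rewrite ?nnegrE ?expR_ge0//; first exact: mulr_ge0.
rewrite expRD expRM_natr.
have k1 : 1 <= 200 ^+ k :> R by rewrite exprn_ege1// ler1n.
have -> : log_mesh k / mesh k = 16 * 10 ^+ 3 * 200 ^+ k.
  rewrite /mesh invrK /log_mesh.
  have -> : 200 ^+ k = 2 ^+ k * 100 ^+ k :> R by rewrite -exprMn; congr (_ ^+ _); lra.
  by move: (2 ^+ k) (100 ^+ k) => x y; lra.
apply: (@le_trans _ _ (4 ^+ k * ((expR 1 * (16 * 10 ^+ 3 + 2)) * 200 ^+ k))).
  rewrite ler_wpM2l// -(mulrA (expR 1)) ler_wpM2l ?expR_ge0//.
  by move: (200 ^+ k) k1 => x; lra.
have -> : 4 ^+ k * ((expR 1 * (16 * 10 ^+ 3 + 2)) * 200 ^+ k)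
   = (expR 1 * (16 * 10 ^+ 3 + 2)) * 800 ^+ k :> R.
  have -> : 800 ^+ k = 4 ^+ k * 200 ^+ k :> R by rewrite -exprMn; congr (_ ^+ _); lra.
  by rewrite mulrCA.
have A0 : 0 <= expR 1 * (16 * 10 ^+ 3 + 2) :> R.
  by apply: mulr_ge0; [exact: expR_ge0|lra].
have e0 := first_entropy_le R.
have e8 : 800 ^+ k <= expR (67 / 10) ^+ k :> R.
  by apply: lerXn2r; [exact: (ler0n R 800)|exact: expR_ge0|exact: expR_ge_800].
have k8 : 0 <= 800 ^+ k :> R := exprn_ge0 k (ler0n R 800).
exact: (ler_pM A0 k8 e0 e8).
Qed.

Lemma tail_exponent0 (c d : R) : 0 <= d ->
  rate * c ^+ 2 * d <= 2 * weight 0 ^+ 2 * (c ^+ 2 * d).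
Proof.
move=> d0; rewrite -mulrA; apply: ler_wpM2r; last by rewrite /weight /rate; lra.
by apply: mulr_ge0 => //; exact: sqr_ge0.
Qed.

(** The quotient weight^2 / (4 mesh) is 2.738 (100/64)^k, which exceeds rate by
    more than 1; for c^2 >= 6.39 this surplus pays for the growth of the entropy
    by ln 800 < 6.7 per level. *)
Lemma tail_exponentS (c d : R) (k : nat) : 0 <= d ->
  639 / 10 ^+ 2 <= c ^+ 2 ->
  (rate * c ^+ 2 + 67 / 10 * k.+1%:R) * d <=
  weight k.+1 ^+ 2 / (4 * mesh k) * (c ^+ 2 * d).
Proof.
move=> d0 c0; rewrite mulrA ler_wpM2r// /mesh /weight.
have -> : (74 / 10 ^+ 3 / 8 ^+ k) ^+ 2 / (4 * (2 * 10 ^+ 3 * 100 ^+ k)^-1) =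
    2738 / 10 ^+ 3 * (100 / 64) ^+ k :> R.
  rewrite !expr_div_n.
  have -> : 64 ^+ k = 8 ^+ k * 8 ^+ k :> R by rewrite -exprMn; congr (_ ^+ _); lra.
  have : 100 ^+ k != 0 :> R by rewrite expf_neq0.
  have : 8 ^+ k != 0 :> R by rewrite expf_neq0.
  by move: (8 ^+ k) (100 ^+ k) => x y x0 y0; field; rewrite x0 y0.
have bern : 1 + 56 / 100 * k%:R <= (100 / 64) ^+ k :> R.
  elim: k => [|k IH]; first by rewrite mulr0 addr0 expr0.
  rewrite (exprS (100 / 64)) -(natr1 k); move: IH (ler0n R k).
  by move: ((100 / 64) ^+ k) (k%:R) => x y; lra.
rewrite -(natr1 k); move: bern (ler0n R k) c0.
move: ((100 / 64) ^+ k) (k%:R) (c ^+ 2) => y x z h1 h2 h3.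
have : 0 <= z * (y - (1 + 56 / 100 * x)) by apply: mulr_ge0; lra.
have : 0 <= (z - 639 / 10 ^+ 2) * x by apply: mulr_ge0; lra.
by rewrite /rate; lra.
Qed.

(** When the claimed probability is positive, c is bounded away from 0. *)
Lemma sqr_ge_of_nontrivial_tail (c rho : R) : 0 <= rho -> entropy + rho < rate * c ^+ 2 ->
  639 / 10 ^+ 2 <= c ^+ 2.
Proof. by rewrite /entropy /rate; move: (c ^+ 2) => x; lra. Qed.

Lemma entropy_gt0 : 0 < entropy.
Proof. by rewrite /entropy; lra. Qed.

Lemma quantile_constant_gt0 : 0 < 7729 / 10 ^+ 4 :> R.
Proof. by lra. Qed.

Lemma quantile_constant : 1 <= rate * (7729 / 10 ^+ 4) ^+ 2.
Proof. by rewrite /rate; lra. Qed.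

End mesh.

(** * Random points *)

Section union_bound.
Context {R : realType} {dO : measure_display} {Omega : measurableType dO}.
Variable P : probability Omega R.

Lemma measurable_bigsetU_seq (I : eqType) (r : seq I) (A : I -> set Omega) :
  (forall i, i \in r -> measurable (A i)) ->
  measurable (\big[setU/set0]_(i <- r) A i).
Proof. by move=> mA; rewrite big_seq; exact: bigsetU_measurable. Qed.

Lemma prob_bigsetU (I : eqType) (r : seq I) (A : I -> set Omega) :
  (forall i, i \in r -> measurable (A i)) ->
  prob P (\big[setU/set0]_(i <- r) A i) <= \sum_(i <- r) prob P (A i).
Proof.
elim: r => [|i r IH] mA; first by rewrite !big_nil /prob measure0.
have mAr j : j \in r -> measurable (A j) by move=> jr; apply: mA; rewrite inE jr orbT.
have mAi : measurable (A i) by apply: mA; exact: mem_head.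
have mU := measurable_bigsetU_seq mAr.
rewrite !big_cons; apply: le_trans (lerD (lexx _) (IH mAr)).
rewrite -lee_fin EFinD -!probE//; last exact: measurableU.
exact: measureU2.
Qed.

Lemma prob_bigsetU_le (I : eqType) (r : seq I) (A : I -> set Omega) (b : R) :
  (forall i, i \in r -> measurable (A i)) ->
  (forall i, i \in r -> prob P (A i) <= b) ->
  prob P (\big[setU/set0]_(i <- r) A i) <= (size r)%:R * b.
Proof.
move=> mA Ab; apply: (le_trans (prob_bigsetU mA)).
rewrite big_seq; apply: (@le_trans _ _ (\sum_(i <- r | i \in r) b)).
  by apply: ler_sum => i; exact: Ab.
by rewrite -big_seq big_const_seq count_predT iter_addr_0 mulr_natl.
Qed.

End union_bound.

Section random_points.
Context {R : realType} {dO : measure_display} {Omega : measurableType dO}.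
Variables (P : probability Omega R) (d N : nat).
Hypotheses (d0 : (0 < d)%N) (N0 : (0 < N)%N).
Variable X : 'I_N -> {RV P >-> d.-tuple R}.

Let p (w : Omega) (n : 'I_N) := X n w.

Lemma measurable_point_in (A : set (d.-tuple R)) (n : 'I_N) : measurable A ->
  measurable [set w | X n w \in A].
Proof.
move=> mA; rewrite (_ : mkset _ = X n @^-1` A).
  by rewrite -[X in measurable X]setTI; exact: measurable_funP.
by apply/seteqP; split => w /=; rewrite inE.
Qed.

Lemma measurable_count_in (A : set (d.-tuple R)) (Q : nat -> bool) :
  measurable A -> measurable [set w | Q #|[pred n | X n w \in A]|].
Proof.
move=> mA.
have := @measurable_hits_pred _ _ N (fun n w => X n w \in A)
  (fun n => measurable_point_in n mA) (fun v => Q #|v|).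
rewrite (_ : [set w | _] = [set w | Q #|[pred n | X n w \in A]|])//.
by apply/funext => w; rewrite /mkset /hits cardsE.
Qed.

Lemma harmonic_covers : exists s : nat -> seq (d.-tuple R),
  (forall n x, x \in s n -> closed_cube x) /\
  forall n y, closed_cube y -> exists v w,
        [/\ v \in origin :: s n, w \in s n,
            forall j, tnth v j <= tnth y j <= tnth w j &
            volume w - volume v <= n.+1%:R^-1].
Proof.
have H n := @bracketing_cover R d n.+1%:R^-1 n%:R d0.
have /choice[s hs] : forall n, exists s : seq (d.-tuple R),
  (forall x, x \in s -> closed_cube x) /\
  forall y, closed_cube y -> exists v w,
        [/\ v \in origin :: s, w \in s,
            forall j, tnth v j <= tnth y j <= tnth w j &
            volume w - volume v <= n.+1%:R^-1].
  move=> n; case: (H n); rewrite ?invr_gt0//.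
    rewrite expRN lef_pV2 ?posrE ?expR_gt0//.
    by apply: le_trans (expR_ge1Dx _); rewrite nat1r.
  by move=> s [_ ? ?]; exists s.
by exists s; split => n; have [] := hs n.
Qed.

(** The supremum over all boxes is controlled by the countably many corners of
    the covers of mesh 1/(n+1): any other box is squeezed between two of them up
    to an error that tends to 0. *)
Lemma measurable_star_discrepancy_le (t : R) :
  measurable [set w | star_discrepancy (p w) <= t].
Proof.
have [s [scube scov]] := harmonic_covers.
have [t0|t0] := ltP t 0.
  rewrite (_ : mkset _ = set0); first exact: measurable0.
  apply/seteqP; split => // w /= /star_discrepancy_le/(_ _ closed_cube_origin).
  by rewrite local_discrepancy_origin// normr0 leNgt t0.
rewrite (_ : mkset _ = \bigcap_(n in [set: nat]) \bigcap_(x in [set` s n])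
    [set w | `| local_discrepancy (p w) x | <= t]).
  apply: bigcapT_measurable => n.
  apply: fin_bigcap_measurable => [|x _]; first exact: finite_seq.
  exact: (measurable_count_in
    (fun m => `| m%:R / N%:R - volume x | <= t) (measurable_box _ _)).
apply/seteqP; split => w.
  by move=> /star_discrepancy_le h n _ x /= /scube /h.
move=> h; apply/star_discrepancy_le => y cy; apply/ler_addgt0Pr => e e0.
pose n := Num.truncn e^-1.
have ne : n.+1%:R^-1 <= e.
  rewrite -[leRHS]invrK lef_pV2 ?posrE ?invr_gt0//.
  by apply/ltW; exact: truncnS_gt.
have [v [u [vs us vyu vol]]] := scov n y cy.
have cv : closed_cube v.
  by move: vs; rewrite inE => /orP[/eqP->|/scube//]; exact: closed_cube_origin.
have vy : corner_le v y by move=> j; have /andP[] := vyu j.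
have yu : corner_le y u by move=> j; have /andP[] := vyu j.
have := local_discrepancy_bracket (p w) cv vy yu (le_trans vol ne).
have : `| local_discrepancy (p w) u | <= t by exact: (h n I).
have : `| local_discrepancy (p w) v | <= t.
  move: vs; rewrite inE => /orP[/eqP->|vs]; last exact: (h n I).
  by rewrite local_discrepancy_origin// normr0.
rewrite !ler_norml; lra.
Qed.

Variable gamma : R.
Hypothesis g0 : 0 <= gamma.
Hypothesis hneg : class_negatively_dependent P anchored_box_differences
  gamma (fun n w => X n w).
Hypothesis hunif : forall n, uniform_on_half_open_cube (X n).

Section increment.
Variables (v x : d.-tuple R).
Hypotheses (cv : closed_cube v) (cx : closed_cube x) (vx : corner_le v x).

Let A := box origin x `\` box origin v.

Let mA : measurable A.
Proof. by apply: measurableD; exact: measurable_box. Qed.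

Let PA n : P [set w | (X n w \in A) = true] = (volume x - volume v)%:E.
Proof.
rewrite -lebesgue_box_difference//; apply: etrans (hunif n mA).
rewrite /distribution /pushforward; congr (P _).
by apply/seteqP; split => w /= => [/set_mem|/mem_set].
Qed.

Let depA : negatively_dependent P gamma (fun n w => X n w \in A).
Proof.
apply: hneg; exists (box origin v); first by exists v.
by exists (box origin x) => //; exists x.
Qed.

Let bad t := [set w |
  t < `| local_discrepancy (p w) x - local_discrepancy (p w) v |].

Let badE t : bad t = [set w |
  t < `| #|hits (fun n w => X n w \in A) w|%:R / N%:R - (volume x - volume v) |].
Proof. by apply/funext => w; rewrite /bad /mkset local_discrepancyB. Qed.

Lemma measurable_increment t : measurable [set w |
  t < `| local_discrepancy (p w) x - local_discrepancy (p w) v |].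
Proof.
rewrite -/(bad t) badE; apply: (@measurable_hits_pred _ _ N _ _
  (fun u => t < `| #|u|%:R / N%:R - (volume x - volume v) |)).
by move=> n; exact: measurable_point_in.
Qed.

Lemma increment_hoeffding t : 0 <= t -> prob P [set w |
    t < `| local_discrepancy (p w) x - local_discrepancy (p w) v |]
  <= 2 * gamma * expR (- (N%:R * (2 * t ^+ 2))).
Proof.
rewrite -/(bad t) badE; apply: hoeffding_negatively_dependent => //.
by move=> n; exact: measurable_point_in.
Qed.

Lemma increment_bernstein t delta :
  0 < delta -> volume x - volume v <= delta -> 0 <= t <= delta ->
  prob P [set w |
    t < `| local_discrepancy (p w) x - local_discrepancy (p w) v |]
  <= 2 * gamma * expR (- (N%:R * (t ^+ 2 / (4 * delta)))).
Proof.
rewrite -/(bad t) badE; apply: bernstein_negatively_dependent => //.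
by move=> n; exact: measurable_point_in.
Qed.

End increment.
End random_points.

(** * The probabilistic bound *)

Lemma mesh_covers (R : realType) (d : nat) : (0 < d)%N ->
  exists (s : nat -> seq (d.-tuple R)) (lo up : nat -> d.-tuple R -> d.-tuple R),
  [/\ forall k, (size (s k))%:R <= expR (-1) * 4^-1 ^+ k *
        expR ((entropy R + 67 / 10 * k%:R) * d%:R) :> R,
      forall k x, x \in s k -> closed_cube x &
      forall k y, closed_cube y ->
        [/\ lo k y \in origin :: s k, up k y \in s k,
            forall j, tnth (lo k y) j <= tnth y j <= tnth (up k y) j &
            volume (up k y) - volume (lo k y) <= mesh R k]].
Proof.
move=> d0.
have /choice[s hs] : forall k, exists s : seq (d.-tuple R),
  [/\ (size s)%:R <= expR (-1) * 4^-1 ^+ k *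
        expR ((entropy R + 67 / 10 * k%:R) * d%:R) :> R,
      forall x, x \in s -> closed_cube x &
      forall y, exists vw : d.-tuple R * d.-tuple R, closed_cube y ->
        [/\ vw.1 \in origin :: s, vw.2 \in s,
            forall j, tnth vw.1 j <= tnth y j <= tnth vw.2 j &
            volume vw.2 - volume vw.1 <= mesh R k]].
  move=> k; have B0 : 0 <= log_mesh R k by apply: mulr_ge0 => //; exact: exprn_ge0.
  have [s [sz cube cov]] := bracketing_cover d0 (mesh_gt0 R k) B0 (expRN_log_mesh R k).
  exists s; split => //; first exact: cover_size_bound.
  move=> y; have [cy|ncy] := pselect (closed_cube y); last by exists (y, y).
  by have [v [w H]] := cov y cy; exists (v, w).
have /choice[b hb] : forall k, exists b : d.-tuple R -> d.-tuple R * d.-tuple R,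
  forall y, closed_cube y ->
        [/\ (b y).1 \in origin :: s k, (b y).2 \in s k,
            forall j, tnth (b y).1 j <= tnth y j <= tnth (b y).2 j &
            volume (b y).2 - volume (b y).1 <= mesh R k].
  by move=> k; have [_ _ /choice[b hb]] := hs k; exists b.
exists s, (fun k y => (b k y).1), (fun k y => (b k y).2); split=> //.
- by move=> k; have [] := hs k.
- by move=> k; have [] := hs k.
Qed.

Section tail.
Context {R : realType} {dO : measure_display} {Omega : measurableType dO}.
Variables (P : probability Omega R) (d N : nat).
Hypotheses (d0 : (0 < d)%N) (N0 : (0 < N)%N).
Variables (rho : R) (X : 'I_N -> {RV P >-> d.-tuple R}).
Hypothesis rho0 : 0 <= rho.
Hypothesis hneg : class_negatively_dependent P anchored_box_differences
  (expR (rho * d%:R)) (fun n w => X n w).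
Hypothesis hunif : forall n, uniform_on_half_open_cube (X n).

(** One level of the union bound: the cover size and the factor gamma are
    absorbed by the exponent, leaving the share 4^(-k) of (2/e) times the
    claimed failure probability. *)
Lemma level_bound (c Y : R) (k n : nat) :
  n%:R <= expR (-1) * 4^-1 ^+ k *
    expR ((entropy R + 67 / 10 * k%:R) * d%:R) :> R ->
  (rate R * c ^+ 2 + 67 / 10 * k%:R) * d%:R <= Y ->
  n%:R * (2 * expR (rho * d%:R) * expR (- Y)) <=
    4^-1 ^+ k * (2 * expR (-1) * expR (- ((rate R * c ^+ 2
                       - entropy R - rho) * d%:R))).
Proof.
move=> hn hY.
have e0 : 0 <= 2 * expR (rho * d%:R) * expR (- Y) by rewrite !mulr_ge0 ?expR_ge0.
apply: (le_trans (ler_wpM2r e0 hn)).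
set E := expR ((_ + _) * _).
have -> : expR (-1) * 4^-1 ^+ k * E * (2 * expR (rho * d%:R) * expR (- Y)) =
   4^-1 ^+ k * (2 * expR (-1) * (E * expR (rho * d%:R) * expR (- Y))) by ring.
rewrite /E -!expRD; apply: ler_wpM2l; first by rewrite exprn_ge0// invr_ge0.
apply: ler_wpM2l; first by rewrite mulr_ge0// expR_ge0.
rewrite ler_expR; move: hY; lra.
Qed.

Lemma star_discrepancy_tail (c : R) : 0 < c ->
  ((1 - expR (- ((rate R * c ^+ 2
                       - entropy R - rho) * d%:R)))%:E
   <= P [set w | (star_discrepancy (fun n => X n w)
                  <= c * Num.sqrt (d%:R / N%:R))%R])%E.
Proof.
move=> c0; set T := c * _.
have dR : 0 < d%:R :> R by rewrite ltr0n.
have NR : 0 < N%:R :> R by rewrite ltr0n.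
(* when the exponent is nonpositive the claimed probability is at most 0 *)
have [triv|main] := leP (rate R * c ^+ 2) (entropy R + rho).
  apply: (@le_trans _ _ 0%E); last exact: measure_ge0.
  rewrite lee_fin subr_le0 -[leLHS]expR0 ler_expR oppr_ge0 pmulr_lle0//.
  by move: triv; lra.
have c639 := sqr_ge_of_nontrivial_tail rho0 main.
have T0 : 0 < T by rewrite mulr_gt0// sqrtr_gt0 divr_gt0.
have TN : N%:R * T ^+ 2 = c ^+ 2 * d%:R.
  by rewrite exprMn sqr_sqrtr ?divr_ge0 ?ltW//; field; rewrite gt_eqF.
have [K [meshK Kmin]] := exists_last_level T0.
have [s [lo [up [sz cube cov]]]] := mesh_covers R d0.
pose t k := weight R k * T.
have t0 k : 0 <= t k by rewrite mulr_ge0 ?weight_ge0 ?ltW.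
(* at level 0 the increment is measured from the empty box *)
pose prev k x := if k is k'.+1 then lo k' x else origin.
have prevP k x : x \in s k -> closed_cube (prev k x) /\ corner_le (prev k x) x.
  case: k => [|k] xs.
    by split; [exact: closed_cube_origin|exact/origin_le/(cube _ _ xs)].
  have [los _ lou _] := cov k x (cube _ _ xs); split => /=.
    by move: los; rewrite inE => /orP[/eqP->|/cube//]; exact: closed_cube_origin.
  by move=> j; have /andP[] := lou j.
pose inc k x := [set w | t k < `| local_discrepancy (fun n => X n w) x -
                   local_discrepancy (fun n => X n w) (prev k x) |].
have minc k x : x \in s k -> measurable (inc k x).
  by move=> xs; have [cv vx] := prevP k x xs; exact: measurable_increment vx _.
pose lev k := \big[setU/set0]_(x <- s k) inc k x.
have mlev k : measurable (lev k).
  by apply: measurable_bigsetU_seq => x; exact: minc.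
pose Bad := \big[setU/set0]_(k <- iota 0 K.+1) lev k.
have mBad : measurable Bad by apply: measurable_bigsetU_seq.
set E := [set w | _].
have mE : measurable E by exact: measurable_star_discrepancy_le.
set Z := expR (- _).
have plev k : (k <= K)%N -> prob P (lev k) <= 4^-1 ^+ k * (2 * expR (-1) * Z).
  move=> kK.
  case: k kK => [|k] kK.
    have H x : x \in s 0%N -> prob P (inc 0%N x) <=
        2 * expR (rho * d%:R) * expR (- (N%:R * (2 * t 0%N ^+ 2))).
      move=> xs; have [cv vx] := prevP 0%N x xs.
      by apply: increment_hoeffding => //; exact: cube xs.
    apply: (le_trans (prob_bigsetU_le (minc 0%N) H)).
    apply: level_bound (sz 0%N) _.
    rewrite mulr0 addr0; apply: le_trans (tail_exponent0 c (ltW dR)) _.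
    by rewrite -TN /t; set u := weight R 0; lra.
  have H x : x \in s k.+1 -> prob P (inc k.+1 x) <=
      2 * expR (rho * d%:R) * expR (- (N%:R * (t k.+1 ^+ 2 / (4 * mesh R k)))).
    move=> xs; have [cv vx] := prevP k.+1 x xs.
    have [_ _ lou vol] := cov k x (cube _ _ xs).
    apply: increment_bernstein => //.
    - exact: cube xs.
    - exact: mesh_gt0.
    - apply: le_trans vol; rewrite lerD2r; apply: ler_prod => j _.
      by have /andP[-> _] := cube _ _ xs j; have /andP[] := lou j.
    - by rewrite t0 Kmin.
  apply: (le_trans (prob_bigsetU_le (minc k.+1) H)).
  apply: level_bound (sz k.+1) _.
  apply: le_trans (tail_exponentS k (ltW dR) c639) _.
  by rewrite -TN /t le_eqVlt; apply/orP; left; apply/eqP; ring.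
have pBad : prob P Bad <= Z.
  have mlevs k : k \in iota 0 K.+1 -> measurable (lev k) by [].
  apply: (le_trans (prob_bigsetU P mlevs)).
  apply: (@le_trans _ _ (\sum_(k <- iota 0 K.+1) 4^-1 ^+ k * (2 * expR (-1) * Z))).
    rewrite big_seq [leRHS]big_seq; apply: ler_sum => k.
    by rewrite mem_iota => /andP[_ kK]; exact: plev.
  rewrite -mulr_suml.
  have geo n : \sum_(k <- iota 0 n) 4^-1 ^+ k <= 4 / 3 :> R.
    have -> : \sum_(k <- iota 0 n) 4^-1 ^+ k = 4 / 3 * (1 - 4^-1 ^+ n) :> R.
      elim: n => [|n IH]; first by rewrite big_nil expr0 subrr mulr0.
      by rewrite -addn1 iotaD big_cat/= big_seq1 IH add0n addn1 exprS; lra.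
    have : 0 <= 4^-1 ^+ n :> R by rewrite exprn_ge0// invr_ge0.
    by lra.
  have e1 : expR (-1) <= 3 / 8 :> R.
    rewrite expRN -[leRHS]invrK lef_pV2 ?posrE ?expR_gt0//.
    by apply: le_trans (expR1_ge R); lra.
  have Z0 : 0 <= Z by exact: expR_ge0.
  rewrite mulrA -[leRHS]mul1r ler_wpM2r//.
  apply: (@le_trans _ _ (4 / 3 * (2 * (3 / 8)))); last by lra.
  apply: ler_pM; [|by rewrite mulr_ge0 ?expR_ge0|exact: geo|by rewrite ler_wpM2l].
  by apply: sumr_ge0 => k _; rewrite exprn_ge0// invr_ge0.
have sub : ~` Bad `<=` E.
  move=> w nBad; apply/star_discrepancy_le => y cy.
  have incr k x : (k <= K)%N -> x \in s k ->
      `| local_discrepancy (fun n => X n w) x -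
         local_discrepancy (fun n => X n w) (prev k x) | <= t k.
    move=> kK xs; rewrite leNgt; apply/negP => big; apply: nBad.
    rewrite /Bad -bigcup_seq; exists k; first by rewrite /mkset mem_iota.
    by rewrite /lev -bigcup_seq; exists x.
  apply: (le_trans (chaining d0 t0 cube cov incr cy)).
  (* by the choice of K the bracketing error is at most t K.+1 *)
  apply: (@le_trans _ _ (\sum_(k < K.+2) t k)).
    by rewrite [leRHS]big_ord_recr lerD2l.
  by rewrite -mulr_suml ler_piMl ?sum_weight// ltW.
apply: (@le_trans _ _ (P (~` Bad))).
  by rewrite probability_setC// probE// -EFinB lee_fin lerD2l lerN2.
by apply: le_measure => //; rewrite inE//; exact: measurableC.
Qed.

Lemma star_discrepancy_quantile (kappa q : R) :
  0 < kappa -> 1 <= rate R * kappa ^+ 2 -> 0 < q < 1 ->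
  (q%:E <= P [set w | (star_discrepancy (fun n => X n w)
     <= kappa * Num.sqrt (entropy R + rho + ln ((1 - q)^-1) / d%:R)
        * Num.sqrt (d%:R / N%:R))%R])%E.
Proof.
move=> kappa0 hkappa /andP[q0 q1].
have dR : 0 < d%:R :> R by rewrite ltr0n.
have q1' : 0 < 1 - q by rewrite subr_gt0.
have ln0 : 0 <= ln ((1 - q)^-1) by rewrite ln_ge0// invf_ge1//; lra.
have L0 : 0 <= ln ((1 - q)^-1) / d%:R := divr_ge0 ln0 (ltW dR).
move SE : (entropy R + rho + ln ((1 - q)^-1) / d%:R) => S.
have S0 : 0 < S by rewrite -SE; exact: ltr_wpDr L0 (ltr_wpDr rho0 (entropy_gt0 R)).
have c0 : 0 < kappa * Num.sqrt S by rewrite mulr_gt0// sqrtr_gt0.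
apply: le_trans (star_discrepancy_tail c0).
rewrite lee_fin lerBrDr -lerBrDl.
rewrite -[leRHS](@lnK R) ?posrE// ler_expR lerNl -lnV ?posrE//.
rewrite -ler_pdivrMr// exprMn sqr_sqrtr ?(ltW S0)// mulrA.
have : 1 * S <= rate R * kappa ^+ 2 * S by apply: ler_wpM2r => //; exact: ltW.
rewrite mul1r -{1}SE => h.
by move: h; move: (ln _ / _) (rate R * _ * S) => u z; lra.
Qed.

End tail.

(* Numerals of ring_scope are unary, so 1.6741 is written 1 + 6741 / 10 ^+ 4
   and 10.7042 is written 10 + 7042 / 10 ^+ 4. *)
Theorem theorem4p4 (R : realType) (dO : measure_display)
    (Omega : measurableType dO) (P : probability Omega R)
    (d N : nat) (hd : (0 < d)%N) (hN : (0 < N)%N)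
    (rho : R) (hrho : 0 <= rho)
    (X : 'I_N -> {RV P >-> d.-tuple R})
    (hX : forall n w, half_open_cube (X n w))
    (hneg : class_negatively_dependent P anchored_box_differences
              (expR (rho * d%:R)) (fun n w => X n w))
    (hunif : forall n, uniform_on_half_open_cube (X n)) :
  (forall c : R, 0 < c ->
     holds_with_probability_at_least P
       [set w | star_discrepancy (fun n => X n w)
                  <= c * Num.sqrt (d%:R / N%:R)]
       (1 - expR (- (((1 + 6741 / 10 ^+ 4) * c ^+ 2
                       - (10 + 7042 / 10 ^+ 4) - rho) * d%:R)))) /\
  (forall q : R, 0 < q < 1 ->
     holds_with_probability_at_least P
       [set w | star_discrepancy (fun n => X n w)
                  <= (7729 / 10 ^+ 4)
                     * Num.sqrt ((10 + 7042 / 10 ^+ 4) + rho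
                                 + ln ((1 - q)^-1) / d%:R)
                     * Num.sqrt (d%:R / N%:R)]
       q).
Proof.
split=> [c c0|q q01]; split.
- exact: measurable_star_discrepancy_le.
- exact: star_discrepancy_tail.
- exact: measurable_star_discrepancy_le.
- apply: (star_discrepancy_quantile hd hN hrho hneg hunif _ _ q01).
    exact: quantile_constant_gt0.
  exact: quantile_constant.
Qed.
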